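(* Let $G$ be a simple undirected graph on the vertex set $[n]=\{1,\dots,n\}$, let $t$ be the number of triangles in $G$, and let $t_{\max}$ be the maximum, over vertices $v$ of $G$, of the number of triangles of $G$ containing $v$. Let $N$ be a positive integer and $p=1/N$. Color each vertex of $G$ independently and uniformly at random with one of $N$ colors (so each vertex receives any given color with probability $p$), and let $T$ be the number of monochromatic triangles, i.e. triangles of $G$ all three of whose vertices receive the same color. Let $\epsilon$ be a small positive constant and $d>0$ any constant. If $$p^2 \geq \frac{4(d+3)\, t_{\max} \log n}{\epsilon^2 t},$$ then $$\Pr\big[\, |T-\mathbb{E}[T]| > \epsilon\, \mathbb{E}[T]\,\big] \leq \frac{1}{n^d}.$$
   Context: Here $\mathbb{E}[T]=p^2 t$. This random coloring is the sampling step of the ''colorful triangle sampling'' algorithm, which keeps exactly the monochromatic edges (edges whose endpoints receive the same color), counts the triangles $T$ among them, and outputs $T/p^2$ as an estimate of $t$. *)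

(* Defs.v *)
From HB Require Import structures.
From mathcomp Require Import all_boot all_order all_algebra.
From mathcomp Require Import reals exp.
Set Implicit Arguments. Unset Strict Implicit. Unset Printing Implicit Defensive.
Import Order.TTheory GRing.Theory Num.Theory.
Local Open Scope ring_scope.

(* A simple graph on [n] is a symmetric irreflexive relation e on 'I_n. *)

Definition is_triangle (n : nat) (e : rel 'I_n) (A : {set 'I_n}) : bool :=
  (#|A| == 3)%N && [forall x in A, forall y in A, (x != y) ==> e x y].

Definition triangles (n : nat) (e : rel 'I_n) : {set {set 'I_n}} :=
  [set A : {set 'I_n} | is_triangle e A].

Definition num_triangles (n : nat) (e : rel 'I_n) : nat := #|triangles e|.

Definition num_triangles_at (n : nat) (e : rel 'I_n) (v : 'I_n) : nat :=
  #|[set A in triangles e | v \in A]|.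

Definition tmax (n : nat) (e : rel 'I_n) : nat :=
  (\max_(v : 'I_n) num_triangles_at e v)%N.

Definition coloring (n N : nat) := {ffun 'I_n -> 'I_N}.

Definition monochromatic (n N : nat) (c : coloring n N) (A : {set 'I_n}) : bool :=
  [forall x in A, forall y in A, c x == c y].

Definition mono_triangles (n N : nat) (e : rel 'I_n) (c : coloring n N) : nat :=
  #|[set A in triangles e | monochromatic c A]|.

(* uniform probability over all N^n colorings (independent uniform colors) *)
Definition prob (R : realType) (n N : nat) (P : pred (coloring n N)) : R :=
  #|[set c : coloring n N | P c]|%:R / #|{: coloring n N}|%:R.

Definition expect (R : realType) (n N : nat) (X : coloring n N -> R) : R :=
  (\sum_(c : coloring n N) X c) / #|{: coloring n N}|%:R.

(* Main.v *)
(* Write m for t_max, mu for E[T] = t / N^2 and 1_A for the indicator that the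
   triangle A is monochromatic. Every vertex lies in at most m triangles, so
   Finner's generalization of Hölder's inequality gives
     E exp(x T / m) <= prod_A (E exp(x 1_A))^(1/m) <= exp(mu (e^x - 1) / m).
   With x = eps/2 or x = - eps/2 and e^x <= 1 + x + x^2, Markov's inequality
   bounds each tail by exp(- eps^2 mu / (4 m)) <= n^-(d+3); finally 2 <= n^3. *)

Require Import Defs.
From HB Require Import structures.
From mathcomp Require Import all_boot all_order all_algebra.
From mathcomp Require Import reals exp.
From mathcomp Require Import sequences ring lra.
Import Order.TTheory GRing.Theory Num.Theory.
Local Open Scope ring_scope.

(** * Exponential estimates and Hölder's inequality on a finite uniform space *)

Section Exponential.
Context {R : realType}.

(** Everything comes from [expR z <= (1 - z)^-1]. For [x <= 0] take [z = x] and use [(1 - x) * (1 +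
    x + x ^+ 2) = 1 - x ^+ 3 >= 1]. *)
Lemma expR_le_quadratic (x : R) : `|x| <= 2^-1 -> expR x <= 1 + x + x ^+ 2.
Proof.
rewrite ler_norml => /andP[x_ge x_le].
have [x0|x0] := leP x 0.
  have h := expR_ge1Dx (- x).
  have p1 : 0 < 1 - x by lra.
  have : expR x <= (1 - x)^-1.
    by rewrite -[expR x]invrK -expRN lef_pV2 ?posrE ?expR_gt0.
  move/le_trans; apply; rewrite -[leLHS]mul1r ler_pdivrMr //.
  have : 0 <= (- x) ^+ 3 by apply: exprn_ge0; lra.
  nra.
(* For [x > 0] the choice [z = x] is too weak, so take [z = x / 4] and raise to the fourth power. *)
pose y := x / 4.
have xE : x = 4 * y by rewrite /y; field.
have y0 : 0 < y by rewrite /y; lra.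
have y8 : y <= 8^-1 by rewrite /y; lra.
have h := expR_ge1Dx (- y).
have p1 : 0 < 1 - y by lra.
have ey : expR y <= (1 - y)^-1.
  by rewrite -[expR y]invrK -expRN lef_pV2 ?posrE ?expR_gt0.
have -> : expR x = expR y ^+ 4 by rewrite xE -expRM_natl.
have : expR y ^+ 4 <= (1 - y)^-1 ^+ 4.
  by apply: lerXn2r; rewrite // nnegrE ?expR_ge0 // invr_ge0 ltW.
move/le_trans; apply; rewrite exprVn -[leLHS]mul1r ler_pdivrMr ?exprn_gt0 //.
rewrite xE.
(* Both inner factors are positive because [y <= 8^-1]; in particular [44 * y <= 11 / 2 < 6]. *)
have -> : (1 + 4 * y + (4 * y) ^+ 2) * (1 - y) ^+ 4
  = 1 + y ^+ 2 * ((6 - 44 * y) + y ^+ 2 * (81 - 60 * y + 16 * y ^+ 2)) by ring.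
have y2 := sqr_ge0 y.
by rewrite lerDl mulr_ge0 // addr_ge0 ?mulr_ge0 //; lra.
Qed.

(* AM-GM for the numbers [expR (y j)], padded with ones up to [m] of them. *)
Lemma expR_mean_le {J : finType} (K : {set J}) (y : J -> R) (m : nat) :
  (0 < m)%N -> (#|K| <= m)%N ->
  expR ((\sum_(j in K) y j) / m%:R)
    <= 1 + (\sum_(j in K) (expR (y j) - 1)) / m%:R.
Proof.
move=> m0 Km; set Y := (X in expR X).
have mR : 0 < m%:R :> R by rewrite ltr0n.
have sumy : \sum_(j in K) y j = m%:R * Y by rewrite /Y mulrC divfK ?gt_eqF.
(* The graph of [expR] lies above its tangent at the padded mean [Y]; [le1] below is the same bound
   at a padding value 0. *)
have tangent j : expR Y * (1 + y j - Y) <= expR (y j).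
  have -> : expR (y j) = expR Y * expR (y j - Y) by rewrite -expRD addrC subrK.
  by rewrite ler_pM2l ?expR_gt0 // -addrA expR_ge1Dx.
have : \sum_(j in K) expR Y * (1 + y j - Y) <= \sum_(j in K) expR (y j).
  by apply: ler_sum => j _.
rewrite -mulr_sumr sumrB big_split /= sumy !sumr_const -[Y *+ _]mulr_natl => h.
rewrite sumrB sumr_const.
have le1 : expR Y * (1 - Y) <= 1.
  have := expR_ge1Dx (- Y); rewrite -(ler_pM2l (expR_gt0 Y)).
  by rewrite -expRD subrr expR0.
have kmR : #|K|%:R <= m%:R :> R by rewrite ler_nat.
rewrite -lerBlDl ler_pdivlMr //.
move: h le1 kmR; set k : R := #|K|%:R; set S := \sum_(j in K) _.
move: (expR Y) => E h le1 kmR.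
have : 0 <= (m%:R - k) * (1 - E * (1 - Y)) by rewrite mulr_ge0 ?subr_ge0.
nra.
Qed.

(** Hölder with all exponents equal to [m], geometric means being written through [ln]. Normalize
    each [h j] by its mean [H j] and apply AM-GM pointwise: the linear terms [h j x / H j - 1] sum
    to zero over [x]. The functions outside [K] are constant and factor out. *)
Lemma hoelder_mean {X J : finType} (K : {set J}) (h : J -> X -> R) (m : nat) :
  (0 < #|X|)%N -> (0 < m)%N -> (#|K| <= m)%N ->
  (forall j x, 0 < h j x) ->
  (forall j, j \notin K -> forall x x', h j x = h j x') ->
  (\sum_x expR ((\sum_j ln (h j x)) / m%:R)) / #|X|%:R
    <= expR ((\sum_j ln ((\sum_x h j x) / #|X|%:R)) / m%:R).
Proof.
move=> X0 m0 Km h0 hK.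
have XR : 0 < #|X|%:R :> R by rewrite ltr0n.
have mR : 0 < m%:R :> R by rewrite ltr0n.
pose H j := (\sum_x h j x) / #|X|%:R.
have H0 j : 0 < H j.
  rewrite divr_gt0 // lt_def sumr_ge0 ?andbT => [|x _]; last exact: ltW.
  have /card_gt0P[x0 _] := X0.
  by rewrite (bigD1 x0) //= gt_eqF // ltr_wpDr ?h0 // sumr_ge0 // => x _; apply: ltW.
have HK j x : j \notin K -> h j x = H j.
  move=> jK; rewrite /H (eq_bigr (fun=> h j x)) => [|x' _]; last exact: hK.
  by rewrite sumr_const -[h j x *+ _]mulr_natr mulfK ?gt_eqF.
rewrite -/H ler_pdivrMr //.
have step x : expR ((\sum_j ln (h j x)) / m%:R) <=
    expR ((\sum_j ln (H j)) / m%:R)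
      * (1 + (\sum_(j in K) (h j x / H j - 1)) / m%:R).
  have -> : (\sum_j ln (h j x)) / m%:R = (\sum_j ln (H j)) / m%:R
     + (\sum_(j in K) (ln (h j x) - ln (H j))) / m%:R.
    rewrite -mulrDl; congr (_ / _).
    rewrite (bigID (mem K)) /= [in RHS](bigID (mem K)) /= sumrB.
    have -> : \sum_(i | i \notin K) ln (h i x) = \sum_(i | i \notin K) ln (H i).
      by apply: eq_bigr => j jK; rewrite HK.
    ring.
  rewrite expRD ler_pM2l ?expR_gt0 //.
  apply: le_trans (expR_mean_le _ _ _ m0 Km) _.
  rewrite lerD2l ler_pM2r ?invr_gt0 //; apply: ler_sum => j _.
  by rewrite expRB !lnK ?posrE.
apply: le_trans (ler_sum _ (fun x _ => step x)) _.
rewrite -mulr_sumr big_split /= sumr_const -mulr_suml exchange_big /=.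
have -> : \sum_(j in K) \sum_x (h j x / H j - 1) = 0; last by rewrite mul0r addr0.
rewrite big1 // => j _; rewrite sumrB -mulr_suml sumr_const.
have -> : \sum_x h j x = H j * #|X|%:R by rewrite /H divfK ?gt_eqF.
by rewrite mulrAC divff ?mul1r ?subrr // gt_eqF.
Qed.

End Exponential.

(** * Averaging over the color of one vertex, and Finner's inequality *)

Section Recoloring.
Context {n N : nat}.
Implicit Types (c : coloring n N) (v : 'I_n).

Definition recolor c v (x : 'I_N) : coloring n N :=
  [ffun u => if u == v then x else c u].

Lemma recolorE c v x u : recolor c v x u = if u == v then x else c u.
Proof. by rewrite ffunE. Qed.

Context {R : realType}.
Implicit Types f : coloring n N -> R.

(** The conditional expectation of [f] given the colors of all vertices other than [v]. *)
Definition avg_at v f c : R := (\sum_(x < N) f (recolor c v x)) / N%:R.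

Context (N_pos : (0 < N)%N).

Let N_neq0 : N%:R != 0 :> R. Proof. by rewrite pnatr_eq0 -lt0n. Qed.

Lemma card_coloring_gt0 : 0 < #|{: coloring n N}|%:R :> R.
Proof. by rewrite ltr0n card_ffun !card_ord expn_gt0 N_pos. Qed.

(** Exchanging the fresh color [x] with the old color of [v] is an involution on pairs, and it turns
    [f (recolor c v x)] into [f c]. *)
Lemma expect_avg_at v f : expect (avg_at v f) = expect f.
Proof.
congr (_ / _); rewrite -mulr_suml pair_bigA /=.
pose swap (p : coloring n N * 'I_N) := (recolor p.1 v p.2, p.1 v).
have swapK : involutive swap.
  move=> [c x]; rewrite /swap /= recolorE eqxx; congr pair.
  by apply/ffunP => u; rewrite !recolorE; case: eqP => // ->.
rewrite (reindex_inj (inv_inj swapK)) /=.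
rewrite (eq_bigr (fun p => f p.1)) => [|[c x] _]; last first.
  congr f; apply/ffunP => u; rewrite /= !recolorE.
  by case: eqP => // ->.
rewrite -(pair_bigA _ (fun c (_ : 'I_N) => f c)) /=.
under eq_bigr do rewrite sumr_const card_ord -[f _ *+ _]mulr_natr.
by rewrite -mulr_suml mulfK.
Qed.

Lemma expect_cst (a : R) : expect (fun _ : coloring n N => a) = a.
Proof.
rewrite /expect sumr_const -[a *+ _]mulr_natr mulfK // gt_eqF //.
exact: card_coloring_gt0.
Qed.

Lemma expectD f g : expect (fun c => f c + g c) = expect f + expect g.
Proof. by rewrite /expect big_split mulrDl. Qed.

Lemma expectMr f (a : R) : expect (fun c => f c * a) = expect f * a.
Proof. by rewrite /expect -mulr_suml mulrAC. Qed.

Lemma expect_sum {J : finType} (P : pred J) (h : J -> coloring n N -> R) :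
  expect (fun c => \sum_(j | P j) h j c) = \sum_(j | P j) expect (h j).
Proof. by rewrite /expect exchange_big mulr_suml. Qed.

Lemma eq_expect f g : f =1 g -> expect f = expect g.
Proof. by move=> fg; rewrite /expect (eq_bigr g). Qed.

Lemma le_expect f g : (forall c, f c <= g c) -> expect f <= expect g.
Proof.
move=> fg; rewrite /expect ler_pM2r ?invr_gt0 ?card_coloring_gt0 //.
exact: ler_sum.
Qed.

(** Markov's inequality: [f] dominates the indicator of [P]. *)
Lemma prob_le_expect (P : pred (coloring n N)) f :
  (forall c, 0 <= f c) -> (forall c, P c -> 1 <= f c) -> prob R P <= expect f.
Proof.
move=> f0 f1; rewrite /prob ler_pM2r ?invr_gt0 ?card_coloring_gt0 //.
rewrite cardsE -sum1_card natr_sum [leRHS](bigID P) /=.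
by rewrite ler_wpDr ?sumr_ge0 // ler_sum // => c; apply: f1.
Qed.

Lemma prob_le_union (P Q1 Q2 : pred (coloring n N)) :
  (forall c, P c -> Q1 c || Q2 c) -> prob R P <= prob R Q1 + prob R Q2.
Proof.
move=> PQ; rewrite /prob -mulrDl ler_pM2r ?invr_gt0 ?card_coloring_gt0 //.
rewrite -natrD ler_nat; apply: leq_trans (leq_card_setU _ _).
by apply: subset_leq_card; apply/subsetP => c; rewrite !inE => /PQ.
Qed.

Definition depends_on (D : pred 'I_n) f :=
  forall c c', {in D, c =1 c'} -> f c = f c'.

Lemma avg_at_depends_on D v f : depends_on D f -> depends_on D (avg_at v f).
Proof.
move=> fD c c' cc'; congr (_ / _); apply: eq_bigr => x _; apply: fD => u uD.
by rewrite !recolorE cc'.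
Qed.

Lemma avg_at_gt0 v f c : (forall c', 0 < f c') -> 0 < avg_at v f c.
Proof.
move=> f0; rewrite divr_gt0 ?ltr0n // (bigD1 (Ordinal N_pos)) //=.
by rewrite ltr_wpDr ?sumr_ge0 // => x _; apply: ltW.
Qed.

(* Finner's inequality: if every coordinate is used by at most [m] of the
   positive functions [h j], then [E (prod h_j^(1/m)) <= prod (E h_j)^(1/m)].
   The coordinates are averaged out one at a time, each by Hölder. *)
Lemma finner {J : finType} (D : J -> pred 'I_n) (h : J -> coloring n N -> R)
    (m : nat) :
  (0 < m)%N -> (forall v, (#|[set j | D j v]| <= m)%N) ->
  (forall j, depends_on (D j) (h j)) -> (forall j c, 0 < h j c) ->
  expect (fun c => expR ((\sum_j ln (h j c)) / m%:R))
    <= expR ((\sum_j ln (expect (h j))) / m%:R).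
Proof.
move=> m0 Dm; move: h.
(* The list [s] holds the vertices not yet averaged out; [D] stays fixed, so its overlap bound
   persists through the induction. *)
suff main (s : seq 'I_n) (h : J -> coloring n N -> R) :
    (forall j, depends_on (D j) (h j)) -> (forall j c, 0 < h j c) ->
    (forall j, depends_on (mem s) (h j)) ->
    expect (fun c => expR ((\sum_j ln (h j c)) / m%:R))
      <= expR ((\sum_j ln (expect (h j))) / m%:R).
  move=> h hD h0; apply: (main (enum 'I_n)) => // j c c' cc'.
  by congr (h j _); apply/ffunP => u; apply: cc'; rewrite inE mem_enum.
elim: s h => [|v s IH] h hD h0 hs.
  pose c0 : coloring n N := [ffun => Ordinal N_pos].
  have hc j c : h j c = h j c0 by apply: hs => u.
  rewrite (eq_expect _ (fun=> expR ((\sum_j ln (h j c0)) / m%:R))); last first.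
    by move=> c; under eq_bigr do rewrite hc.
  rewrite expect_cst (eq_bigr (fun j => ln (expect (h j)))) // => j _.
  by rewrite (eq_expect _ (fun=> h j c0)) ?expect_cst.
have {}IH := IH (fun j => avg_at v (h j)).
have -> : \sum_j ln (expect (h j)) = \sum_j ln (expect (avg_at v (h j))).
  by apply: eq_bigr => j _; rewrite expect_avg_at.
apply: le_trans (IH _ _ _); last first.
- move=> j c c' cc'; congr (_ / _); apply: eq_bigr => x _; apply: hs => u.
  rewrite unfold_in /= in_cons => uvs; rewrite !recolorE.
  by case: eqP uvs => //= _; apply: cc'.
- by move=> j c; apply: avg_at_gt0.
- by move=> j; apply: avg_at_depends_on.
(* With the other colors fixed, this is Hölder in the color of [v]; [h j] is constant in that color
   unless [D j v]. *)
rewrite -(expect_avg_at v); apply: le_expect => c.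
have cX : #|'I_N| = N by rewrite card_ord.
have := @hoelder_mean R 'I_N J [set j | D j v] (fun j x => h j (recolor c v x)) m.
rewrite /avg_at cX; apply=> // j; rewrite inE => jv x x'; apply: hD => u uD.
by rewrite !recolorE; case: eqP => // uv; rewrite uv unfold_in (negPf jv) in uD.
Qed.

End Recoloring.

(** * Monochromatic triangles: mean, moment generating function and tails *)

Section Triangles.
Context {R : realType} {n N : nat} (e : rel 'I_n) (N_pos : (0 < N)%N).

Lemma triangleP {A} : A \in triangles e ->
  exists u v w, [/\ u != v, u != w, v != w & A = [set u; v; w]].
Proof.
rewrite inE => /andP[/eqP A3 _].
have /card_gt0P[u uA] : (0 < #|A|)%N by rewrite A3.
have A2 : #|A :\ u| = 2%N by move: A3; rewrite (cardsD1 u) uA => -[].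
have /cards2P[v [w [vw AE]]] : #|A :\ u| == 2%N by rewrite A2.
have : v \in A :\ u by rewrite AE !inE eqxx.
have : w \in A :\ u by rewrite AE !inE eqxx orbT.
rewrite !in_setD1 => /andP[wu _] /andP[vu _].
exists u, v, w; split => //; [by rewrite eq_sym | by rewrite eq_sym |].
by rewrite -(setD1K uA) AE setUA.
Qed.

Lemma monochromatic3 (c : coloring n N) u v w :
  monochromatic c [set u; v; w] = (c v == c u) && (c w == c u).
Proof.
apply/forall_inP/andP => [H|[/eqP vu /eqP wu] a aA].
  have uA : u \in [set u; v; w] by rewrite !inE eqxx.
  by split; apply: (forall_inP (H _ _)) uA; rewrite !inE eqxx !orbT.
have ca b : b \in [set u; v; w] -> c b = c u.
  by rewrite !inE => /orP[/orP[]|] /eqP ->.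
by apply/forall_inP => b bA; rewrite !ca.
Qed.

(** Keep the color of [u] and average out [v], then [w]; each matches it with probability
    [N%:R^-1]. *)
Lemma expect_monochromatic A : A \in triangles e ->
  expect (fun c : coloring n N => (monochromatic c A)%:R : R) = N%:R^-1 ^+ 2.
Proof.
move=> /triangleP[u [v [w [uv uw vw ->]]]].
rewrite -(expect_avg_at N_pos v) -(expect_avg_at N_pos w).
rewrite (@eq_expect _ _ _ _ (fun=> N%:R^-1 ^+ 2)) ?expect_cst // => c.
have sum_delta (x0 : 'I_N) (a : R) : \sum_x (x == x0)%:R * a = a.
  by rewrite (bigD1 x0) //= eqxx mul1r big1 ?addr0 // => x /negPf ->; rewrite mul0r.
have avg_v c' : avg_at v (fun c : coloring n N =>
    (monochromatic c [set u; v; w])%:R : R) c' = (c' w == c' u)%:R * N%:R^-1.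
  rewrite /avg_at -[in RHS](sum_delta (c' u) (c' w == c' u)%:R).
  congr (_ / _); apply: eq_bigr => x _.
  rewrite monochromatic3 !recolorE eqxx (negPf uv) [w == v]eq_sym (negPf vw).
  by rewrite -mulnb natrM.
rewrite {1}/avg_at expr2; congr (_ / _).
rewrite -[RHS](sum_delta (c u)); apply: eq_bigr => x _.
by rewrite avg_v !recolorE eqxx (negPf uw).
Qed.

Lemma mono_trianglesE (c : coloring n N) :
  (mono_triangles e c)%:R = \sum_(A in triangles e) (monochromatic c A)%:R :> R.
Proof.
rewrite /mono_triangles -sum1_card natr_sum.
rewrite (eq_bigl (fun A => (A \in triangles e) && monochromatic c A)); last first.
  by move=> A; rewrite inE.
by rewrite big_mkcondr; apply: eq_bigr => A _; case: monochromatic.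
Qed.

Lemma expect_mono_triangles :
  expect (fun c : coloring n N => (mono_triangles e c)%:R : R)
    = (num_triangles e)%:R * N%:R^-1 ^+ 2.
Proof.
rewrite (eq_expect _ _ mono_trianglesE) expect_sum.
by rewrite (eq_bigr _ expect_monochromatic) sumr_const -[LHS]mulr_natl.
Qed.

Lemma tmax_gt0 : (0 < num_triangles e)%N -> (0 < tmax e)%N.
Proof.
move=> /card_gt0P[A At]; have [u [v [w [_ _ _ AE]]]] := triangleP At.
apply: leq_trans (leq_bigmax u); apply/card_gt0P; exists A.
by rewrite inE At AE !inE eqxx.
Qed.

Lemma triangle_card_ge3 : (0 < num_triangles e)%N -> (3 <= n)%N.
Proof.
move=> /card_gt0P[A]; rewrite inE => /andP[/eqP <- _].
by rewrite -[leqRHS](card_ord n) max_card.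
Qed.

Lemma mgf_mono_triangles (x : R) : (0 < tmax e)%N ->
  expect (fun c : coloring n N => expR (x * (mono_triangles e c)%:R / (tmax e)%:R))
  <= expR ((num_triangles e)%:R * N%:R^-1 ^+ 2 * (expR x - 1) / (tmax e)%:R).
Proof.
move=> m0; have mR : 0 < (tmax e)%:R :> R by rewrite ltr0n.
(* The index runs over all vertex sets; a set that is not a triangle gets the constant 1, whose
   logarithm vanishes, and an empty [D A]. *)
pose h A (c : coloring n N) : R :=
  if A \in triangles e then expR (x * (monochromatic c A)%:R) else 1.
have h0 A c : 0 < h A c by rewrite /h; case: ifP => _; rewrite ?expR_gt0.
pose D A : pred 'I_n := fun v => (A \in triangles e) && (v \in A).
have hD A : depends_on (D A) (h A).
  move=> c c' cc'; rewrite /h; case: ifP => // At.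
  suff -> : monochromatic c A = monochromatic c' A by [].
  have ccA u : u \in A -> c u = c' u.
    by move=> uA; apply: cc'; rewrite unfold_in /D At.
  apply: eq_forallb_in => u uA; apply: eq_forallb_in => v vA.
  by rewrite !ccA.
have Dm v : (#|[set A | D A v]| <= tmax e)%N.
  by apply: leq_trans (leq_bigmax v); rewrite /num_triangles_at.
have := finner N_pos D h _ m0 Dm hD h0.
rewrite (@eq_expect _ _ _ _
  (fun c => expR (x * (mono_triangles e c)%:R / (tmax e)%:R))); last first.
  move=> c; congr (expR (_ / _)); rewrite mono_trianglesE mulr_sumr.
  rewrite [RHS]big_mkcond; apply: eq_bigr => A _; rewrite /h.
  by case: ifP => _; rewrite ?expRK ?ln1.
move/le_trans; apply; rewrite ler_expR ler_pM2r ?invr_gt0 //.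
have -> : (num_triangles e)%:R * N%:R^-1 ^+ 2 * (expR x - 1)
    = \sum_(A in triangles e) N%:R^-1 ^+ 2 * (expR x - 1).
  by rewrite sumr_const -mulrA mulr_natl.
rewrite [leRHS]big_mkcond; apply: ler_sum => A _.
case: ifP => At; last first.
  by rewrite (@eq_expect _ _ _ _ (fun=> 1)) ?expect_cst ?ln1 // => c; rewrite /h At.
(* For [b] in {0, 1}, [expR (x * b) = 1 + b * (expR x - 1)], which makes the expectation linear in
   the indicator. *)
rewrite (@eq_expect _ _ _ _
  (fun c => 1 + (monochromatic c A)%:R * (expR x - 1))); last first.
  move=> c; rewrite /h At; case: monochromatic.
    by rewrite mulr1 mul1r addrC subrK.
  by rewrite mulr0 mul0r addr0 expR0.
rewrite expectD expect_cst // expectMr expect_monochromatic //.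
(* The argument must exceed -1: it equals [q * expR x - q] with [q = N%:R^-1 ^+ 2] at most 1. *)
apply: le_ln1Dx.
have N1 : 1 <= N%:R :> R by rewrite ler1n.
have q0 : 0 < N%:R^-1 ^+ 2 :> R by rewrite exprn_gt0 // invr_gt0 ltr0n.
have q1 : N%:R^-1 ^+ 2 <= 1 :> R.
  by rewrite expr_le1 // ?invr_ge0 ?ler0n // invf_le1 // ltr0n.
have : 0 < N%:R^-1 ^+ 2 * expR x by rewrite mulr_gt0 ?expR_gt0.
by rewrite mulrBr mulr1; lra.
Qed.

(** Chernoff's method. The factor [x] on both sides of the event lets one statement serve the upper
    tail ([x > 0]) and the lower tail ([x < 0]). *)
Lemma tail_mono_triangles (x a mu : R) : (0 < tmax e)%N -> `|x| <= 2^-1 ->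
  mu = (num_triangles e)%:R * N%:R^-1 ^+ 2 ->
  prob R (fun c : coloring n N => x * a <= x * ((mono_triangles e c)%:R - mu))
    <= expR ((mu * x ^+ 2 - x * a) / (tmax e)%:R).
Proof.
move=> m0 x12 muE; have mR : 0 < (tmax e)%:R :> R by rewrite ltr0n.
have mu0 : 0 <= mu by rewrite muE mulr_ge0 ?ler0n // sqr_ge0.
pose f (c : coloring n N) : R :=
  expR (x * (mono_triangles e c)%:R / (tmax e)%:R)
    * expR (- (x * (mu + a)) / (tmax e)%:R).
have fE c : f c = expR ((x * ((mono_triangles e c)%:R - mu) - x * a) / (tmax e)%:R).
  by rewrite /f -expRD -mulrDl; congr (expR (_ / _)); ring.
apply: (le_trans (prob_le_expect N_pos _ f _ _)).
- by move=> c; rewrite fE expR_ge0.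
- by move=> c xa; rewrite fE -[leLHS]expR0 ler_expR divr_ge0 ?subr_ge0 // ltW.
rewrite expectMr.
apply: (@le_trans _ _ (expR (mu * (expR x - 1) / (tmax e)%:R) *
    expR (- (x * (mu + a)) / (tmax e)%:R))).
  by rewrite ler_pM2r ?expR_gt0 // muE mgf_mono_triangles.
rewrite -expRD -mulrDl ler_expR ler_pM2r ?invr_gt0 //.
have := ler_wpM2l mu0 (expR_le_quadratic x x12).
lra.
Qed.

End Triangles.

(** * Concentration of the number of monochromatic triangles *)

Theorem theorem3 (R : realType) (n : nat) (e : rel 'I_n)
  (e_sym : symmetric e) (e_irr : irreflexive e)
  (N : nat) (N_pos : (0 < N)%N)
  (eps d : R) (eps_pos : 0 < eps) (eps_small : eps < 1) (d_pos : 0 < d)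
  (t_pos : (0 < num_triangles e)%N) :
  4 * (d + 3) * (tmax e)%:R * ln (n%:R : R) / (eps ^+ 2 * (num_triangles e)%:R)
    <= (N%:R ^-1) ^+ 2 ->
  prob R (fun c : coloring n N =>
    eps * expect (fun c' : coloring n N => (mono_triangles e c')%:R : R)
      < `| (mono_triangles e c)%:R - expect (fun c' : coloring n N => (mono_triangles e c')%:R : R) |)
  <= ((n%:R : R) `^ d)^-1.
Proof.
move=> hyp; have m0 := tmax_gt0 e t_pos; have n3 := triangle_card_ge3 e t_pos.
rewrite expect_mono_triangles //; set mu := _ * _ ^+ 2.
have mR : 0 < (tmax e)%:R :> R by rewrite ltr0n.
have tR : 0 < (num_triangles e)%:R :> R by rewrite ltr0n.
have nR : 0 < n%:R :> R by rewrite ltr0n (leq_trans _ n3).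
set L := ln _ in hyp.
have hL : - (eps ^+ 2 * mu / 4 / (tmax e)%:R) <= - (d * L) - 3 * L.
  move: hyp; rewrite ler_pdivrMr ?mulr_gt0 ?exprn_gt0 //.
  have -> : N%:R^-1 ^+ 2 * (eps ^+ 2 * (num_triangles e)%:R) = eps ^+ 2 * mu.
    by rewrite /mu; ring.
  move=> hyp; rewrite -opprD lerN2 ler_pdivlMr //; lra.
(* The deviation is [a = 2 * x * mu], that is, plus or minus [eps * mu]; this [x] minimizes
   [mu * x ^+ 2 - x * a] for that [a], with value [- (eps ^+ 2 * mu / 4)]. *)
have tail x : (x = eps / 2 \/ x = - (eps / 2)) ->
    prob R (fun c : coloring n N =>
      x * (2 * x * mu) <= x * ((mono_triangles e c)%:R - mu))
    <= expR (- (d * L) - 3 * L).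
  move=> xE; apply: le_trans (tail_mono_triangles _ N_pos _ _ _ m0 _ erefl) _.
    by case: xE => ->; rewrite ?normrN ger0_norm; lra.
  rewrite ler_expR; apply: le_trans hL.
  have x2 : x ^+ 2 = eps ^+ 2 / 4 by case: xE => ->; field.
  have -> : mu * x ^+ 2 - x * (2 * x * mu) = - (mu * x ^+ 2) by ring.
  by rewrite x2 !mulNr mulrA [mu * _]mulrC.
have tailp := tail _ (or_introl erefl); have tailm := tail _ (or_intror erefl).
apply: le_trans (prob_le_union N_pos _ _ _ _) (le_trans (lerD tailp tailm) _).
  move=> c; rewrite lter_normr => /orP[] h; apply/orP; [left|right].
    by rewrite ler_pM2l; lra.
  by rewrite ler_nM2l; lra.
(* After the common factor [expR (- (d * L))] is cancelled, [2 <= n ^ 3] remains, and [n >= 3] since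
   a triangle exists. *)
rewrite /powR gt_eqF // -/L -expRN -mulr2n -[leLHS]mulr_natr expRD -mulrA.
have n3L : expR (3 * L) = n%:R ^+ 3 by rewrite expRM_natl lnK.
rewrite -[leRHS]mulr1 ler_pM2l ?expR_gt0 // expRN n3L mulrC.
rewrite ler_pdivrMr ?exprn_gt0 // mul1r -natrX ler_nat.
by rewrite (leq_trans (ltnW n3)) // -[leqLHS]expn1 leq_pexp2l // (leq_trans _ n3).
Qed.
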